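(* Consider a storage system in which each object $f_i$ can be downloaded either from its systematic server or from any one of $t$ disjoint recovery groups, each consisting of $r$ servers, under the Fork-Join access model, with all service times i.i.d. $\mathrm{Exp}(\mu)$. Under the low-traffic regime, the download time $T_{\text{FJ-}(r,t)}$ of a request satisfies, for all $s \ge 0$, $$\Pr\{T_{\text{FJ-}(r,t)} > s\} = e^{-\mu s}\left(1 - (1 - e^{-\mu s})^r\right)^t,$$ and $$\mathbb{E}[T_{\text{FJ-}(r,t)}] = \frac{1}{\mu r}\,\beta\!\left(t+1, \frac{1}{r}\right),$$ where $\beta(x,y)=\int_0^1 v^{x-1}(1-v)^{y-1}\,dv$ is the beta function.
   Context: Storage model: $k$ objects $f_1,\dots,f_k$ (symbols of a finite field) are encoded by a systematic $(n,k)$ linear code and the $n$ coded symbols are stored on $n$ distinct servers. The code has $(r,t)$-availability: for each systematic server $i$ (storing $f_i$) there are $t$ pairwise disjoint recovery groups, each a set of $r$ servers not containing server $i$, such that $f_i$ can be recovered from the contents of any one recovery group. Fork-Join access model: when a request for $f_i$ arrives, it is replicated into $t+1$ copies, one sent to systematic server $i$ and one to each of the $t$ recovery groups; a copy sent to a recovery group is forked into $r$ sub-copies, one to each server of the group, and that copy completes when all $r$ sub-copies have finished service. The request completes as soon as either its copy at the systematic server finishes or its copy at some recovery group completes; all its remaining copies are then immediately removed at no cost. Each server serves one (sub-)copy at a time, and service times are independent across servers and copies, each distributed as $\mathrm{Exp}(\mu)$. The download time of a request is its departure time minus its arrival time. Low-traffic regime: each request is completed before the next request arrives, so at most one request is in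 the system at any time. *)

(* Defs.v *)
From HB Require Import structures.
From mathcomp Require Import all_boot all_order all_algebra.
From mathcomp Require Import all_classical all_reals all_analysis.
Set Implicit Arguments. Unset Strict Implicit. Unset Printing Implicit Defensive.
Import Order.TTheory GRing.Theory Num.Theory.
Local Open Scope classical_set_scope.
Local Open Scope ring_scope.

(* Mutual independence of a finite family of real random variables:
   the product rule for every family of Borel sets (taking B i = setT
   recovers the product rule over every subfamily). *)
Definition mutually_independent {d} {T : measurableType d} {R : realType}
  (P : probability T R) (I : finType) (X : I -> T -> R) : Prop :=
  forall B : I -> set R, (forall i, measurable (B i)) ->
    P (\bigcap_(i in [set: I]) (X i @^-1` B i)) =
    ((\prod_(i : I) fine (P (X i @^-1` B i)))%:E).

Definition is_exponential {d} {T : measurableType d} {R : realType}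
  (P : probability T R) (mu : R) (X : T -> R) : Prop :=
  forall B : set R, measurable B -> P (X @^-1` B) = exponential_prob mu B.

Definition beta_function {R : realType} (x y : R) : R :=
  Rintegral lebesgue_measure `[0, 1]
    (fun v : R => powR v (x - 1) * powR (1 - v) (y - 1)).

(* Servers involved in a request for f_i: the systematic server (None) and
   server k of recovery group j (Some (j, k)). *)
Definition server (t r : nat) := option ('I_t * 'I_r)%type.

(* Completion time of the copy sent to recovery group j (Fork-Join: all r
   sub-copies must finish). *)
Definition group_time {T : Type} {R : realType} (t r : nat)
  (S : server t r -> T -> R) (j : 'I_t) (w : T) : R :=
  \big[Num.max/0]_(k < r) S (Some (j, k)) w.

(* Download time of a request in the low-traffic regime: the first of the
   t+1 copies to complete. *)
Definition download_time_FJ {T : Type} {R : realType} (t r : nat)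
  (S : server t r -> T -> R) (w : T) : R :=
  \big[Num.min/S None w]_(j < t) group_time S j w.

(* Main.v *)
(** For the tail, the events "every server of group [j] has finished by time
    [s]" multiply over any set of groups by independence; complementing them
    one at a time gives the probability that no group has finished.

    For the mean, [E T] is the integral of the tail over the half-line. If [Q]
    is a polynomial with [Q' = (1 - X^r)^t], then [Q(1 - exp(-mu s)) / mu] is an
    antiderivative of the tail and [- r Q((1 - v)^(1/r))] one of the beta
    integrand, so both integrals are multiples of [Q(1) - Q(0)]. *)
Require Import Defs.
From HB Require Import structures.
From mathcomp Require Import all_boot all_order all_algebra.
From mathcomp Require Import all_classical all_reals all_analysis.
From mathcomp Require Import measurable_realfun ring.
Import Order.TTheory GRing.Theory Num.Theory.
Import numFieldNormedType.Exports.
Local Open Scope classical_set_scope.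
Local Open Scope ring_scope.

(** * Calculus: polynomial antiderivatives and an improper fundamental theorem *)

Lemma ex_antideriv_poly (R : numFieldType) (p : {poly R}) :
  exists q : {poly R}, q^`() = p.
Proof.
(* At [i = 0] the division is by zero and returns 0, so the constant term vanishes. *)
exists (\poly_(i < (size p).+1) (p`_i.-1 / i%:R)); apply/polyP => i.
rewrite coef_deriv coef_poly ltnS; have [ip|pi] := ltnP; last first.
  by rewrite mul0rn nth_default.
by rewrite -[LHS]mulr_natr /= divfK// pnatr_eq0.
Qed.

Lemma is_derive1_continuous (R : realType) (f : R -> R) (x df : R) :
  is_derive x 1 f df -> f y @[y --> x] --> f x.
Proof. by move=> dfx; exact/differentiable_continuous/derivable1_diffP. Qed.

(** The integrand may blow up at [b], as the beta integrand does at 1 when [r > 1]. The interval is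
    exhausted by compact ones, and nonnegativity permits monotone convergence. *)
Lemma ge0_continuous_FTC2_bndo (R : realType) (f F : R -> R) (a b l : R) :
  a < b ->
  (forall x, a <= x < b -> 0 <= f x) ->
  (forall x, a <= x < b -> {for x, continuous f}) ->
  (forall x, a <= x < b -> is_derive x 1 F (f x)) ->
  F x @[x --> b^'-] --> l ->
  (\int[lebesgue_measure]_(x in `[a, b[) (f x)%:E = l%:E - (F a)%:E)%E.
Proof.
move=> ab f0 cf dF Fl.
(* The shift by 2 keeps [e 0] strictly above [a], so that every [[a, e n]] is nondegenerate. *)
pose e n : R := b - (b - a) / n.+2%:R.
have ba0 : 0 < b - a by rewrite subr_gt0.
have eb n : e n < b by rewrite /e gtrBl divr_gt0.
have ae n : a < e n.
  by rewrite /e ltrBrDl -ltrBrDr gtr_pMr// invf_lt1 ?ltr1n.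
have nde m n : (m <= n)%N -> e m <= e n.
  by move=> mn; rewrite lerB// ler_pM2l// lef_pV2 ?posrE// ler_nat.
have ecvg : e n @[n --> \oo] --> b.
  rewrite -[X in _ --> X]subr0; apply: cvgB; first exact: cvg_cst.
  rewrite -(mulr0 (b - a)); apply: cvgM; first exact: cvg_cst.
  by rewrite (cvg_shiftS (@harmonic R)); exact: cvg_harmonic.
have inD n x : x \in `[a, e n] -> a <= x < b.
  by rewrite in_itv/= => /andP[-> /le_lt_trans]; apply.
have cfn n : {within `[a, e n], continuous f}.
  by apply: continuous_in_subspaceT => x; rewrite inE => /inD /cf.
have -> : `[a, b[%classic = \bigcup_n `[a, e n]%classic.
  apply/seteqP; split => x /=; last by move=> [n _] /inD; rewrite in_itv.
  rewrite in_itv/= => /andP[ax xb].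
  have /cvgr_ge/(_ _ xb)[n _ xe] := ecvg.
  by exists n => //=; rewrite in_itv/= ax xe/=.
have Icvg := @ge0_nondecreasing_set_cvg_integral _ (measurableTypeR R) R
  (fun n => `[a, e n]%classic) (EFin \o f) (@lebesgue_measure R).
(* The integrals over [[a, e n]] have two limits to compare: the integral over the union, and
   [l - F a] computed from the antiderivative. *)
apply: cvg_unique (Icvg _ _ _ _) _ => //.
- move=> m n mn; apply/subsetPset => x /=; rewrite !in_itv/= => /andP[->].
  by move/le_trans; apply; exact: nde.
- move=> n; apply/measurable_EFinP.
  exact: subspace_continuous_measurable_fun.
- by move=> n x /inD/f0; rewrite /= lee_fin.
have FTCn n :
    (\int[lebesgue_measure]_(x in `[a, e n]) (f x)%:E = (F (e n) - F a)%:E)%E.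
  have cF x : a <= x < b -> {for x, continuous F}.
    by move=> /dF dFx; exact: is_derive1_continuous dFx.
  rewrite (@continuous_FTC2 _ f F)//.
  - split; first by move=> x /subset_itv_oo_cc /inD /dF dFx.
    + by apply/cvg_at_right_filter/cF; rewrite lexx.
    + by apply/cvg_at_left_filter/cF; rewrite ltW//= eb.
  - by move=> x /subset_itv_oo_cc /inD /dF dFx; rewrite derive1E derive_val.
rewrite /=; under eq_cvg do rewrite FTCn.
apply: cvg_EFin; first exact: nearW.
apply: cvgB; last exact: cvg_cst.
by apply: (cvg_at_leftP _ _ _).1 Fl _ _; split.
Qed.

Lemma powR_invnK (R : realType) (x : R) (n : nat) : (0 < n)%N -> 0 <= x ->
  (x `^ n%:R^-1) ^+ n = x.
Proof.
move=> n0 x0; rewrite -powR_mulrn ?powR_ge0// -powRrM mulVf ?powRr1//.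
by rewrite pnatr_eq0 -lt0n.
Qed.

(** Along sequences, [u n] tending to 1 from below makes [1 - u n] tend to 0 from above, where the
    power has limit 0. *)
Lemma cvg_onem_powR_at_left1 (R : realType) (c : R) : 0 < c ->
  (1 - x) `^ c @[x --> 1^'-] --> (0 : R).
Proof.
move=> c0; apply/cvg_at_leftP => u [u1 ucvg].
suff v0 : (forall n, 0 < 1 - u n) /\ 1 - u n @[n --> \oo] --> (0 : R).
  have [+ _] := cvg_at_rightP (fun x : R => x `^ c) 0 0.
  by move=> /(_ (powR_cvg0 c0)) /(_ (fun n => 1 - u n) v0).
split; first by move=> n; rewrite subr_gt0.
by rewrite -[X in _ --> X](subrr 1); apply: cvgB => //; exact: cvg_cst.
Qed.

(** * The beta and tail integrals in terms of one polynomial *)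

Section antiderivative.
Context {R : realType} (r t : nat) (Q : {poly R}).
Hypotheses (r_gt0 : (0 < r)%N) (dQ : Q^`() = (1 - 'X^r) ^+ t).

(** Put [u = (1 - v)^(1/r)]: then [Q'(u) = (1 - u^r)^t = v^t], and the factor [r] cancels the [1/r]
    produced by differentiating the power. *)
Lemma integral_beta_antideriv :
  (\int[lebesgue_measure]_(v in `[0%R, 1%R])
    (v `^ (t%:R + 1 - 1) * (1 - v) `^ (r%:R^-1 - 1))%:E =
  (r%:R * (Q.[1] - Q.[0]))%:E)%E.
Proof.
have r0 : r%:R != 0 :> R by rewrite pnatr_eq0 -lt0n.
pose f (v : R) := v ^+ t * (1 - v) `^ (r%:R^-1 - 1).
pose F (v : R) : R := - r%:R * Q.[(1 - v) `^ r%:R^-1].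
transitivity (\int[lebesgue_measure]_(v in `[0%R, 1%R]) (f v)%:E)%E.
  apply: eq_integral => v; rewrite inE/= in_itv/= => /andP[v0 _].
  by rewrite addrK powR_mulrn.
have mf : measurable_fun setT f.
  apply: measurable_funM; first exact: measurable_funX.
  apply: (@measurableT_comp _ _ _ _ _ _ (fun x : R => x `^ (r%:R^-1 - 1))).
    by [].
  exact: measurable_funB.
(* The possible singularity at [v = 1] is a null set and is dropped. *)
rewrite -integral_itv_bndo_bndc; last exact/measurable_EFinP/measurable_funTS.
have dpow (x : R) c : x < 1 ->
    is_derive x 1 (fun v => (1 - v) `^ c) (- (c * (1 - x) `^ (c - 1))).
  move=> x1; have x10 : 0 < 1 - x by rewrite subr_gt0.
  have := @is_derive1_comp R (fun y => y `^ c) (fun v => 1 - v) x _ _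
    (is_derive1_powR c x10) (is_deriveB
      (is_derive_cst (1 : R) x 1) (is_derive_id x 1)).
  by rewrite sub0r mulrN1.
transitivity ((- r%:R * Q.[0])%:E - (F 0)%:E)%E; last first.
  rewrite /F subr0 powR1 -EFinB; congr EFin.
  by rewrite !mulNr opprK addrC mulrBr.
apply: ge0_continuous_FTC2_bndo => //.
- by move=> x /andP[x0 _]; rewrite mulr_ge0 ?exprn_ge0 ?powR_ge0.
- move=> x /andP[_ x1]; apply: cvgM; first exact: exprn_continuous.
  exact: is_derive1_continuous (dpow x (r%:R^-1 - 1) x1).
- move=> x /andP[x0 x1].
  have dF := is_deriveZ (- r%:R)
    (@is_derive1_comp R (horner Q) (fun v => (1 - v) `^ r%:R^-1) x _ _
      (is_derive_poly Q _) (dpow x r%:R^-1 x1)).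
  apply: (trigger_derive dF).
  rewrite dQ !hornerE powR_invnK// ?subr_ge0 1?ltW// opprB addrC subrK.
  rewrite /f scaleNr mulrN scalerN opprK /GRing.scale/= mulrCA; congr *%R.
  by rewrite mulrA divff// mul1r.
- apply: cvgM; first exact: cvg_cst.
  apply: cvg_comp; last exact: continuous_horner.
  by apply: cvg_onem_powR_at_left1; rewrite invr_gt0 ltr0n.
Qed.

(** Put [u = 1 - exp(-mu s)]: then [du = mu exp(-mu s) ds], and [u] runs from 0 to 1 as [s] runs
    over the half-line. *)
Lemma integral_tail_antideriv (mu : R) : 0 < mu ->
  (\int[lebesgue_measure]_(s in `[0%R, +oo[)
    (expR (- mu * s) * (1 - (1 - expR (- mu * s)) ^+ r) ^+ t)%:E =
  (mu^-1 * (Q.[1] - Q.[0]))%:E)%E.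
Proof.
move=> mu0.
pose f (s : R) := expR (- mu * s) * (1 - (1 - expR (- mu * s)) ^+ r) ^+ t.
pose F (s : R) : R := mu^-1 * Q.[1 - expR (- mu * s)].
have dexp (x : R) :
    is_derive x 1 (fun s => 1 - expR (- mu * s)) (mu * expR (- mu * x)).
  have := is_deriveB (is_derive_cst (1 : R) x 1)
    (@is_derive1_comp R (@expR R) (fun s => - mu * s) x _ _
      (is_derive_expR (- mu * x)) (is_deriveZ (- mu) (is_derive_id x 1))).
  by rewrite sub0r /GRing.scale/= mulr1 mulrN opprK mulrC.
have dF (x : R) : is_derive x 1 F (f x).
  have dFx := is_deriveZ mu^-1
    (@is_derive1_comp R (horner Q) (fun s => 1 - expR (- mu * s)) x _ _
      (is_derive_poly Q _) (dexp x)).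
  apply: (trigger_derive dFx).
  rewrite dQ !hornerE /GRing.scale/= -mulrA mulrCA mulKf ?gt_eqF//.
  by rewrite mulrC.
have cexp : continuous (fun s : R => expR (- mu * s)).
  move=> s; apply: continuous_comp; last exact: continuous_expR.
  by apply: cvgM; [exact: cvg_cst|exact: cvg_id].
have cvgexp : expR (- mu * s) @[s --> +oo] --> (0 : R).
  rewrite (_ : (fun s => _) = (fun z => expR (- z)) \o (fun z => mu * z)).
    apply: (@cvg_comp _ _ _ _ _ _ (pinfty_nbhs R)); last exact: cvgr_expR.
    exact: gt0_cvgMry.
  by apply/funext => s; rewrite /= mulNr.
rewrite (@ge0_continuous_FTC2y _ f F _ (mu^-1 * Q.[1])).
- by rewrite /F mulr0 expR0 subrr -EFinB mulrBr.
- move=> x x0.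
  have e1 : expR (- mu * x) <= 1.
    by rewrite -expR0 ler_expR mulNr oppr_le0 mulr_ge0// ltW.
  rewrite mulr_ge0 ?expR_ge0// exprn_ge0// subr_ge0.
  by apply: exprn_ile1; [rewrite subr_ge0|rewrite gerBl expR_ge0].
(* The tail is a polynomial in [exp(-mu s)], hence continuous. *)
- have -> : f = horner ('X * (1 - (1 - 'X) ^+ r) ^+ t) \o
      (fun s => expR (- mu * s)).
    by apply/funext => s; rewrite /= !hornerE.
  apply: continuous_subspaceT => x.
  by apply: continuous_comp; [exact: cexp|exact: continuous_horner].
- apply: cvgM; first exact: cvg_cst.
  have c1 : 1 - expR (- mu * s) @[s --> +oo] --> (1 : R).
    by rewrite -[X in _ --> X]subr0; apply: cvgB => //; exact: cvg_cst.
  by apply: (@cvg_comp _ _ _ _ (horner Q) _ _ _ c1); exact: continuous_horner.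
- by move=> x _; have := dF x.
- by apply: cvg_at_right_filter; exact: is_derive1_continuous (dF 0).
- by move=> x _; have dFx := dF x; rewrite derive1E derive_val.
Qed.

End antiderivative.

(** * Exponential tails and complements of independent events *)

Section exponential_tail.
Context {d} {T : measurableType d} {R : realType} (P : probability T R).
Context (mu : R) (X : {RV P >-> R}).
Hypothesis expX : is_exponential P mu X.

Lemma exponential_lt0 : P (X @^-1` `]-oo, 0[) = 0%E.
Proof.
rewrite expX//; apply: integral0_eq => x; rewrite /= in_itv/= => x0.
by rewrite lt0_exponential_pdf.
Qed.

Lemma exponential_cdf (s : R) : 0 <= s ->
  P (X @^-1` `]-oo, s]) = (1 - expR (- mu * s))%:E.
Proof.
move=> s0.
have -> : X @^-1` `]-oo, s] = (X @^-1` `]-oo, 0[) `|` (X @^-1` `[0, s]).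
  apply/seteqP; split => w; rewrite /= !in_itv/=.
    by case: ltP => _ Xs; [left|right].
  by move=> [/ltW/le_trans|/andP[]//]; apply.
rewrite measureU; [|exact: measurable_funPTI|exact: measurable_funPTI|].
- rewrite [X in (X + _)%E]exponential_lt0 add0e [LHS]expX//.
  (* At [s = 0] the interval is a single point and both sides are 0. *)
  move: s0; rewrite le_eqVlt => /predU1P[<-|s0]; last first.
    exact: exponential_prob_itv0c.
  by rewrite mulr0 expR0 subrr /exponential_prob set_itv1 integral_set1.
- apply/seteqP; split => w //=; rewrite !in_itv/= => -[+ /andP[+ _]].
  by move=> /lt_le_trans h /h; rewrite ltxx.
Qed.

Lemma exponential_ccdf (s : R) : 0 <= s ->
  P (X @^-1` `]s, +oo[) = (expR (- mu * s))%:E.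
Proof.
move=> s0; have mXs : measurable (X @^-1` `]-oo, s]).
  exact: measurable_funPTI.
rewrite -setCitvl preimage_setC probability_setC.
  by rewrite exponential_cdf// -EFinB subKr.
exact: mXs.
Qed.

End exponential_tail.

(* Replacing one [G j] at a time by its complement:
   [P (A `&` ~` G j) = P A - P (A `&` G j)]. *)
Lemma probability_bigsetIC {d} {T : measurableType d} {R : realType}
    (P : probability T R) (J : eqType) (E : set T) (G : J -> set T) (c g : R) :
  measurable E -> (forall j, measurable (G j)) ->
  (forall K : seq J, uniq K ->
    P (E `&` \big[setI/setT]_(j <- K) G j) = (c * g ^+ size K)%:E) ->
  forall L K : seq J, uniq (L ++ K) ->
  P (E `&` \big[setI/setT]_(j <- K) G j `&` \big[setI/setT]_(j <- L) ~` G j) =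
  (c * g ^+ size K * (1 - g) ^+ size L)%:E.
Proof.
move=> mE mG PG; elim=> [|l L IH] K uLK.
  by rewrite big_nil setIT expr0 mulr1; exact: PG.
move: uLK => /= /andP[lLK uLK]; rewrite big_cons.
set GK := \big[_/_]_(j <- K) _; set CL := \big[_/_]_(j <- L) _.
have mA : measurable (E `&` GK `&` CL).
  apply: measurableI.
    by apply: measurableI => //; apply: bigsetI_measurable.
  by apply: bigsetI_measurable => j _; exact: measurableC.
have -> : E `&` GK `&` (~` G l `&` CL) = (E `&` GK `&` CL) `\` G l.
  by rewrite setDE -!setIA (setIC CL).
rewrite measureD//; last by rewrite ltey_eq fin_num_measure.
(* The subtracted event has [l] moved to the uncomplemented list, so the induction hypothesis must
   hold for every [K]. *)
have -> : E `&` GK `&` CL `&` G l =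
    E `&` \big[setI/setT]_(j <- l :: K) G j `&` CL.
  rewrite big_cons -/GK -!setIA (setIC CL) !setIA.
  by rewrite -(setIA E) (setIC GK) setIA.
have ulK : uniq (L ++ l :: K).
  by rewrite uniq_catC/= mem_cat orbC -mem_cat lLK uniq_catC.
rewrite [X in (X - _)%E](IH _ uLK) [X in (_ - X)%E](IH _ ulK) -EFinB.
by congr EFin; rewrite !exprS; ring.
Qed.

(** * Indexing by servers, and measurability of finite extrema *)

Lemma big_option (R : Type) (idx : R) (op : Monoid.com_law idx) (I : finType)
    (F : option I -> R) :
  \big[op/idx]_i F i = op (F None) (\big[op/idx]_i F (Some i)).
Proof.
rewrite (bigD1 None)//=; congr (op _ _).
rewrite (reindex_omap Some id) => [|[]//]; apply: eq_bigl => i.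
by rewrite eqxx.
Qed.

Lemma measurable_fun_bigmaxr {d} {T : measurableType d} {R : realType}
    (I : Type) (s : seq I) (f0 : T -> R) (f : I -> T -> R) :
  measurable_fun setT f0 -> (forall i, measurable_fun setT (f i)) ->
  measurable_fun setT (fun w => \big[Num.max/f0 w]_(i <- s) f i w).
Proof.
move=> mf0 mf; elim: s => [|i s IH]; first by under eq_fun do rewrite big_nil.
by under eq_fun do rewrite big_cons; exact: measurable_maxr.
Qed.

(** The initial value is itself a random variable because the minimum in [download_time_FJ] starts
    from [S None]. *)
Lemma measurable_fun_bigminr {d} {T : measurableType d} {R : realType}
    (I : Type) (s : seq I) (f0 : T -> R) (f : I -> T -> R) :
  measurable_fun setT f0 -> (forall i, measurable_fun setT (f i)) ->
  measurable_fun setT (fun w => \big[Num.min/f0 w]_(i <- s) f i w).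
Proof.
move=> mf0 mf; elim: s => [|i s IH]; first by under eq_fun do rewrite big_nil.
by under eq_fun do rewrite big_cons; exact: measurable_minr.
Qed.

(** * Law and mean of the download time *)

Section fork_join.
Context {d} {T : measurableType d} {R : realType} (P : probability T R).
Context (mu : R) (r t : nat) (S : server t r -> {RV P >-> R}).
Hypothesis indepS : mutually_independent P (fun i => (S i : T -> R)).
Hypothesis expS : forall i, is_exponential P mu (S i).

Let group := group_time (fun i => (S i : T -> R)).
Let download := download_time_FJ (fun i => (S i : T -> R)).

Lemma measurable_group_time j : measurable_fun setT (group j).
Proof. by apply: measurable_fun_bigmaxr => // k; exact: measurable_funPT. Qed.

Lemma measurable_download_time : measurable_fun setT download.
Proof.
apply: measurable_fun_bigminr; first exact: measurable_funPT.
exact: measurable_group_time.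
Qed.

Lemma measurable_group_le j (s : R) : measurable [set w | group j w <= s].
Proof.
rewrite -[X in measurable X]setTI.
have -> : [set w | group j w <= s] = group j @^-1` `]-oo, s].
  by apply/seteqP; split => w /=; rewrite in_itv.
exact: measurable_group_time.
Qed.

Lemma probability_groups_le (s : R) (K : seq 'I_t) : 0 <= s -> uniq K ->
  P (S None @^-1` `]s, +oo[ `&`
     \big[setI/setT]_(j <- K) [set w | group j w <= s]) =
  (expR (- mu * s) * ((1 - expR (- mu * s)) ^+ r) ^+ size K)%:E.
Proof.
move=> s0 uK.
(* The event is a product of half-lines over the servers; groups outside [K] receive [setT] and
   contribute a factor 1. *)
pose B (i : server t r) : set R :=
  if i is Some (j, k) then if j \in K then `]-oo, s]%classic else setT
  else `]s, +oo[%classic.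
have mB i : measurable (B i).
  by case: i => [[j k]|] //=; case: ifP.
have -> : S None @^-1` `]s, +oo[ `&`
     \big[setI/setT]_(j <- K) [set w | group j w <= s] =
     \bigcap_(i in [set: server t r]) (S i @^-1` B i).
  rewrite -bigcap_seq; apply/seteqP; split => w /=.
    move=> [Ns Kw] [[j k]|] _ //=; case: ifPn => //= jK.
    by rewrite in_itv/=; have /bigmax_leP[_ ->] := Kw j jK.
  move=> Bw; split; first exact: (Bw None).
  (* The maximum starts from 0, so the bound by [s] also uses [0 <= s]. *)
  move=> j /= jK; apply/bigmax_leP; split=> // k _.
  by have /= := Bw (Some (j, k)) I; rewrite jK /= in_itv.
rewrite indepS// big_option/= (exponential_ccdf P mu _ (expS None))//=;
  congr (_ * _)%:E.
transitivity (\prod_(j < t) \prod_(k < r)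
    (if j \in K then 1 - expR (- mu * s) else 1)).
  rewrite pair_bigA; apply: eq_bigr => -[j k] _ /=.
  by case: ifPn => jK;
    rewrite ?(exponential_cdf P mu _ (expS _))// preimage_setT probability_setT.
under eq_bigr do rewrite prodr_const card_ord.
rewrite -(card_uniqP uK) -prodr_const [RHS]big_mkcond; apply: eq_bigr => j _.
by case: ifP; rewrite ?expr1n.
Qed.

Lemma download_time_ccdf (s : R) : 0 <= s ->
  P [set w | download w > s] =
  (expR (- mu * s) * (1 - (1 - expR (- mu * s)) ^+ r) ^+ t)%:E.
Proof.
move=> s0.
(* All [t] groups are complemented at once, starting from an empty [K]; here [c = exp(-mu s)] and
   [g = (1 - exp(-mu s))^r]. *)
have := @probability_bigsetIC _ _ _ P 'I_t (S None @^-1` `]s, +oo[)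
  (fun j => [set w | group j w <= s]) _ _ (measurable_funPTI _ _)
  (fun j => measurable_group_le j s)
  (fun K => @probability_groups_le s K s0) (enum 'I_t) [::].
rewrite cats0 enum_uniq big_nil setIT expr0 mulr1 size_enum_ord => <- //.
congr (P _); rewrite -bigcap_seq; apply/seteqP; split => w /=.
  move/bigmin_gtP => [Ns js]; split; first by rewrite in_itv/= Ns.
  by move=> j _ /=; apply/negP; rewrite -ltNge js.
rewrite in_itv/= andbT => -[Ns js]; apply/bigmin_gtP; split=> // j _.
by rewrite ltNge; apply/negP/js; rewrite /= mem_enum.
Qed.

(** The layer-cake formula applies to nonnegative variables, so the download time is replaced by its
    positive part, which equals it almost surely. *)
Lemma expectation_download_time :
  ('E_P[download] = \int[lebesgue_measure]_(s in `[0%R, +oo[)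
    (expR (- mu * s) * (1 - (1 - expR (- mu * s)) ^+ r) ^+ t)%:E)%E.
Proof.
pose D : {RV P >-> R} :=
  HB.pack download (isMeasurableFun.Build _ _ _ _ _ measurable_download_time).
(* The systematic service time is nonnegative only almost surely. *)
transitivity ('E_P[D^\+])%E.
  rewrite unlock; apply: ae_eq_integral => //.
  - exact/measurable_EFinP/measurable_download_time.
  - exact/measurable_EFinP/measurable_funrpos/measurable_download_time.
  exists (S None @^-1` `]-oo, 0[); split.
  - exact: measurable_funPTI.
  - exact: exponential_lt0 (expS None).
  - move=> w /= Dw; rewrite in_itv/= ltNge; apply/negP => Nw; apply: Dw => _.
    (* Group times are maxima starting from 0, so only [S None] could make the minimum negative. *)
    rewrite /funrpos max_l//; apply/bigmin_geP; split=> // j _.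
    exact: bigmax_ge_id.
rewrite ge0_expectation_ccdf; last by move=> w; exact: funrpos_ge0.
apply: eq_integral => s; rewrite inE/= in_itv/= andbT => s0.
(* For [s >= 0], exceeding [s] is the same for a number and its positive part. *)
rewrite -download_time_ccdf//; congr (P _); apply/seteqP; split => w /=;
  by rewrite in_itv/= /funrpos lt_max (ltNge s 0) s0 orbF andbT.
Qed.

End fork_join.

Theorem theorem1 {d} (T : measurableType d) (R : realType)
  (P : probability T R) (mu : R) (r t : nat)
  (S : server t r -> {RV P >-> R}) :
  0 < mu -> (0 < r)%N -> (0 < t)%N ->
  mutually_independent P (fun i => (S i : T -> R)) ->
  (forall i, is_exponential P mu (S i)) ->
  (forall s : R, 0 <= s ->
     P [set w | download_time_FJ (fun i => (S i : T -> R)) w > s] =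
     (expR (- mu * s) * (1 - (1 - expR (- mu * s)) ^+ r) ^+ t)%:E) /\
  ('E_P[download_time_FJ (fun i => (S i : T -> R))])%E =
     ((mu * r%:R)^-1 * beta_function (t%:R + 1) (r%:R^-1))%:E.
Proof.
move=> mu0 r0 _ indepS expS; split=> [s s0|]; first exact: download_time_ccdf.
(* The same [Q] serves both integrals, so [Q(1) - Q(0)] need not be evaluated. *)
have [Q dQ] := @ex_antideriv_poly R ((1 - 'X^r) ^+ t).
rewrite (expectation_download_time P mu)// (integral_tail_antideriv _ _ _ dQ)//.
rewrite /beta_function /Rintegral (integral_beta_antideriv _ _ _ r0 dQ)/=.
by rewrite invfM -mulrA mulKf// pnatr_eq0 -lt0n.
Qed.
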